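(* Let $G$ be a finite group with identity $1$ and let $S\subseteq G$ satisfy $1\notin S$ and $S=S^{-1}$. Then the Cayley graph $Cay(G,S)$ is strongly regular with parameters $(|G|,|S|,\lambda,\mu)$ if and only if $|C(v,S)|=\lambda$ for every $v\in S$ and $|C(v',S)|=\mu$ for every $v'\in\overline{S}$.
   Context: For a subset $S$ of a group $G$, $\overline{S}=G\setminus(S\cup\{1\})$, and for $v\in G$, $C(v,S)=\{(x,y) : x,y\in S \text{ and } v=xy\}$ (ordered pairs). The Cayley graph $Cay(G,S)$ has vertex set $G$, with $x,y$ adjacent iff $x^{-1}y\in S$. A strongly regular graph with parameters $(n,r,\lambda,\mu)$ is an $r$-regular graph on $n$ vertices in which any two adjacent vertices have exactly $\lambda$ common neighbours and any two distinct non-adjacent vertices have exactly $\mu$ common neighbours (connectedness is not required in this definition). *)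

(* Defs.v *)
From HB Require Import structures.
From mathcomp Require Import all_boot all_fingroup.

Set Implicit Arguments.
Unset Strict Implicit.
Unset Printing Implicit Defensive.

Local Open Scope group_scope.

(* A simple graph on a finite vertex type is a symmetric irreflexive boolean
   adjacency relation. *)

Definition neighbours (T : finType) (e : rel T) (x : T) : {set T} :=
  [set y | e x y].

Definition common_neighbours (T : finType) (e : rel T) (x y : T) : {set T} :=
  neighbours e x :&: neighbours e y.

(* Connectedness is not required, and empty and complete graphs are allowed:
   with no adjacent (resp. distinct non-adjacent) pair of vertices, lambda
   (resp. mu) is unconstrained. *)
Record strongly_regular (T : finType) (e : rel T) (n r lambda mu : nat) : Prop :=
  StronglyRegular {
    srg_sym : symmetric e;
    srg_irr : irreflexive e;
    srg_order : #|T| = n;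
    srg_regular : forall x, #|neighbours e x| = r;
    srg_adj : forall x y, e x y -> #|common_neighbours e x y| = lambda;
    srg_nadj : forall x y, x != y -> ~~ e x y ->
                 #|common_neighbours e x y| = mu
  }.

Definition Cay (gT : finGroupType) (S : {set gT}) : rel gT :=
  fun x y => x^-1 * y \in S.

Definition co_connection (gT : finGroupType) (S : {set gT}) : {set gT} :=
  [set: gT] :\: (S :|: [set 1]).

Definition C (gT : finGroupType) (v : gT) (S : {set gT}) : {set gT * gT} :=
  [set xy : gT * gT | [&& xy.1 \in S, xy.2 \in S & v == xy.1 * xy.2]].

(* Main.v *)
Require Import Defs.
From mathcomp Require Import all_boot all_fingroup.

(** Left translations are automorphisms of a Cayley graph, so the number of
    common neighbours of [x] and [y] can only depend on the quotient
    [v := x^-1 * y].  It is in fact the number of factorizations of [v] in [S]: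
    a path [x, z, y] of length two is the same thing as the factorization
    [v = (x^-1 * z) * (z^-1 * y)], whose factors are the two steps of the path
    ([card_common_neighbours_Cay]).

    Moreover [x] and [y] are adjacent exactly when [v] lies in [S], and distinct
    and non-adjacent exactly when [v] lies in [co_connection S]; every [v] occurs
    as such a quotient, for instance that of the pair [(1, v)].  Hence the two
    common-neighbour conditions of strong regularity are the two conditions on
    [C v S].  The remaining clauses always hold for a Cayley graph: symmetry
    comes from [S = S^-1], irreflexivity from [1 \notin S], and the
    neighbourhood of [x] is the coset [x *: S]. *)

Local Open Scope group_scope.

Section CayleyGraph.

Variables (gT : finGroupType) (S : {set gT}).

Lemma Cay_irreflexive : 1 \notin S -> irreflexive (Cay S).
Proof. by move=> S1 x; rewrite /Cay mulVg; apply: negbTE. Qed.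

Lemma Cay_symmetric : S = S^-1 -> symmetric (Cay S).
Proof. by move=> SV x y; rewrite /Cay {1}SV mem_invg invMg invgK. Qed.

Lemma neighbours_Cay x : neighbours (Cay S) x = x *: S.
Proof. by apply/setP=> y; rewrite inE mem_lcoset. Qed.

Lemma mem_co_connection v :
  (v \in co_connection S) = (v != 1) && (v \notin S).
Proof. by rewrite !inE andbT negb_or andbC. Qed.

(** The map sending [z] to the two steps of the path [x, z, y] is a bijection
    onto the factorizations of [x^-1 * y].  Symmetry of [S] is what allows the
    second step to be read from [z] to [y], whereas adjacency of [y] and [z]
    gives it from [y] to [z]. *)
Lemma card_common_neighbours_Cay x y :
  S = S^-1 -> #|common_neighbours (Cay S) x y| = #|C (x^-1 * y) S|.
Proof.
move=> SV; pose steps z := (x^-1 * z, z^-1 * y).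
have steps_inj : injective steps by move=> z t [/mulgI].
rewrite -(card_imset _ steps_inj); congr #|pred_of_set _|.
apply/setP=> -[a b]; rewrite inE /=.
apply/imsetP/and3P=> [[z] | [aS bS /eqP def_ab]].
  rewrite !inE => /andP[xz yz] [-> ->]; split=> //.
    by move: yz; rewrite -/(Cay S y z) Cay_symmetric.
  by rewrite mulgA mulgK.
have def_b : (x * a)^-1 * y = b by rewrite invMg -mulgA def_ab mulKg.
exists (x * a); last by rewrite /steps mulKg def_b.
by rewrite !inE (Cay_symmetric SV y) /Cay mulKg aS def_b.
Qed.

End CayleyGraph.

Theorem theorem5 (gT : finGroupType) (S : {set gT}) (lambda mu : nat)
    (S1 : 1 \notin S) (SV : S = S^-1) :
  strongly_regular (Cay S) #|[set: gT]| #|S| lambda mu <->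
  (forall v, v \in S -> #|C v S| = lambda) /\
  (forall v', v' \in co_connection S -> #|C v' S| = mu).
Proof.
split=> [[_ _ _ _ adj nadj] | [adj nadj]].
  have card_C v : #|C v S| = #|common_neighbours (Cay S) 1 v|.
    by rewrite card_common_neighbours_Cay // invg1 mul1g.
  have Cay1 v : Cay S 1 v = (v \in S) by rewrite /Cay invg1 mul1g.
  split=> v; first by rewrite card_C -Cay1; apply: adj.
  by rewrite mem_co_connection card_C eq_sym -Cay1 => /andP[]; apply: nadj.
split.
- exact: Cay_symmetric.
- exact: Cay_irreflexive.
- by rewrite cardsT.
- by move=> x; rewrite neighbours_Cay card_lcoset.
- by move=> x y xy; rewrite card_common_neighbours_Cay // adj.
move=> x y neq_xy not_xy; rewrite card_common_neighbours_Cay // nadj //.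
by rewrite mem_co_connection -eq_mulVg1 neq_xy.
Qed.
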